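(* Every singleton or doubleton set of positive integers is the score set of some oriented bipartite graph. That is, for every positive integer $a$ there is an oriented bipartite graph with score set $\{a\}$, and for all positive integers $a_1<a_2$ there is an oriented bipartite graph with score set $\{a_1,a_2\}$.
   Context: An oriented bipartite graph $D(U,V)$ is obtained by assigning a direction to each edge of a simple bipartite graph with parts $U=\{u_1,\dots,u_m\}$ and $V=\{v_1,\dots,v_n\}$. For a vertex $x$, let $d_x^+$ and $d_x^-$ denote its outdegree and indegree. The score of $u\in U$ is $a_u=n+d_u^+-d_u^-$ and the score of $v\in V$ is $b_v=m+d_v^+-d_v^-$. The score set of $D(U,V)$ is the set of distinct scores of all its vertices. *)

(* Defs.v *)
From HB Require Import structures.
From mathcomp Require Import all_boot all_order all_algebra.
From mathcomp Require Import finmap.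

Set Implicit Arguments.
Unset Strict Implicit.
Unset Printing Implicit Defensive.

Import Order.TTheory GRing.Theory Num.Theory.
Local Open Scope ring_scope.

(* The vertex set is the disjoint union of U = 'I_m (left summand) and
   V = 'I_n (right summand). *)
Definition vertex (m n : nat) : finType := ('I_m + 'I_n)%type.

Definition in_U (m n : nat) (x : vertex m n) : bool :=
  if x is inl _ then true else false.

(* Loops are excluded by [edge_across]; the edge set may be empty. *)
Record bipartite_graph (m n : nat) := BipartiteGraph {
  edge : rel (vertex m n);
  edge_sym : symmetric edge;
  edge_across : forall x y, edge x y -> in_U x != in_U y
}.

(* [arc x y] says that the edge xy is directed from x to y. *)
Record oriented_bipartite_graph (m n : nat) := OrientedBipartiteGraph {
  underlying : bipartite_graph m n;
  arc : rel (vertex m n);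
  arc_edge : forall x y, arc x y -> edge underlying x y;
  arc_oriented : forall x y, edge underlying x y -> arc x y (+) arc y x
}.

Section Score.

Variables (m n : nat) (D : oriented_bipartite_graph m n).

Definition outdegree (x : vertex m n) : nat := #|[set y | arc D x y]|.

Definition indegree (x : vertex m n) : nat := #|[set y | arc D y x]|.

Definition opposite_size (x : vertex m n) : nat := if in_U x then n else m.

Definition score (x : vertex m n) : int :=
  (opposite_size x)%:Z + (outdegree x)%:Z - (indegree x)%:Z.

Definition score_set : {fset int} := [fset score x | x : vertex m n]%fset.

End Score.

(* Main.v *)
Require Import Defs.
From HB Require Import structures.
From mathcomp Require Import all_boot all_order all_algebra.
From mathcomp Require Import finmap.

Set Implicit Arguments.
Unset Strict Implicit.
Unset Printing Implicit Defensive.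

Import Order.TTheory GRing.Theory Num.Theory.
Local Open Scope ring_scope.

(** A bipartite graph may have no edges at all. Every degree then vanishes, so each vertex of U
    scores [n] and each vertex of V scores [m]. With both parts nonempty the score set is exactly
    {n, m}, and choosing the part sizes yields any one or two positive integers
    ([score_set_edgeless]). *)

Definition edgeless_graph (m n : nat) : bipartite_graph m n :=
  @BipartiteGraph m n (fun _ _ => false) (fun _ _ => erefl)
    (fun _ _ => notF \; False_ind _).

Definition edgeless (m n : nat) : oriented_bipartite_graph m n :=
  @OrientedBipartiteGraph m n (edgeless_graph m n) (fun _ _ => false)
    (fun _ _ => id) (fun _ _ => notF \; False_ind _).

(** With a constantly false [arc], outdegree and indegree are convertible, so they cancel by [addrK]
    without being computed. *)
Lemma score_edgeless (m n : nat) (x : vertex m n) :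
  score (edgeless m n) x = (opposite_size x)%:Z.
Proof. by rewrite /score addrK. Qed.

(** Positivity supplies a vertex in each part, so that both values are attained. *)
Lemma score_set_edgeless (m n : nat) : (0 < m)%N -> (0 < n)%N ->
  score_set (edgeless m n) = [fset n%:Z; m%:Z]%fset.
Proof.
move=> m_gt0 n_gt0; apply/fsetP => z; rewrite !inE.
apply/imfsetP/orP => [[x _ ->]|[/eqP ->|/eqP ->]].
- by rewrite score_edgeless; case: x => i; rewrite eqxx; [left | right].
- by exists (inl (Ordinal m_gt0)); rewrite ?score_edgeless.
- by exists (inr (Ordinal n_gt0)); rewrite ?score_edgeless.
Qed.

Theorem theorem2p1 :
  (forall a : int, 0 < a ->
    exists (m n : nat) (D : oriented_bipartite_graph m n),
      score_set D = [fset a]%fset)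
  /\
  (forall a1 a2 : int, 0 < a1 -> a1 < a2 ->
    exists (m n : nat) (D : oriented_bipartite_graph m n),
      score_set D = [fset a1; a2]%fset).
Proof.
split=> [[a|//] a_gt0 | [a1|//] [a2|//] a1_gt0 lt_a12].
  exists a, a, (edgeless a a).
  by rewrite score_set_edgeless // fsetUid.
(* The sizes are swapped because a vertex of U scores the size of V: this gives {a1, a2} in the
   required order. *)
exists a2, a1, (edgeless a2 a1).
by rewrite score_set_edgeless // -ltz_nat (lt_trans a1_gt0).
Qed.
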